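(* For all $n \in \mathbb{Z}^+$, there exists a universal cycle for $\mathcal{W}(n)$.
   Context: A weak order on $[n]=\{1,\dots,n\}$ is a relation that is transitive and complete. It is represented by the word $w = w_1w_2\ldots w_n$ in which $w_j$ is the height of element $j$, i.e. the number of symbols $\prec$ preceding $j$ when the weak order is written as a permutation of $[n]$ with consecutive symbols separated by $\equiv$ or $\prec$. Thus $\mathcal{W}(n)$ is identified with the set of all words $w_1w_2\ldots w_n$ of length $n$ over the nonnegative integers such that $\{w_1,\dots,w_n\} = \{0,1,\dots,h\}$ for some $h$ with $0 \le h \le n-1$. Let $\mathcal{C}$ be a set of $N$ strings, each of length $m$. A universal cycle (ucycle) for $\mathcal{C}$ is a word $a_0a_1\ldots a_{N-1}$ such that each $c \in \mathcal{C}$ appears exactly once as a subword $a_{i+1}a_{i+2}\ldots a_{i+m}$ (one value of $i$ modulo $N$), where subscripts are taken modulo $N$. (In particular every such subword is a string in $\mathcal{C}$.) *)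

(* Defs.v *)
From mathcomp Require Import all_boot.
From mathcomp Require Import boolp classical_sets functions cardinality.

Set Implicit Arguments.
Unset Strict Implicit.
Unset Printing Implicit Defensive.

Local Open Scope classical_set_scope.
Local Open Scope card_scope.

(* Position j of the word (0-based) is the height of the element j + 1. *)
Definition weak_orders (n : nat) : set (n.-tuple nat) :=
  [set w | exists2 h : nat, h <= n.-1 & [set x | x \in w] = [set k | k <= h]].
Arguments weak_orders : clear implicits.

(* a_{i+1} ... a_{i+m} for a = a_0 ... a_{N-1}, subscripts modulo N; m may
   exceed N. The default value of nth is only reached when N = 0. *)
Definition cyclic_subword (N m : nat) (a : N.-tuple nat) (i : nat) :
    m.-tuple nat :=
  [tuple nth 0 a ((i + j.+1) %% N) | j < m].

(* Since C has exactly N elements, every cyclic subword of length m of a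
   universal cycle is in C. *)
Definition universal_cycle (N m : nat) (C : set (m.-tuple nat))
    (a : N.-tuple nat) : Prop :=
  C #= `I_N /\
  forall c, C c -> exists! i : 'I_N, cyclic_subword m a i = c.

(* Main.v *)
Require Import Defs.
From mathcomp Require Import all_boot.
From mathcomp Require Import boolp classical_sets functions cardinality.
From mathcomp Require Import perm fingroup zify.

(** The edges of the transition graph on words of length n - 1 are the weak
    orders, and rotating a word is a permutation of the edges that maps each
    edge to one starting where it ends.  Composing such a permutation with the
    transposition of two edges that have the same source but lie in different
    orbits gives another one and merges these orbits; so if it has the fewest
    orbits, then all edges with the same source are in a single orbit.  An
    orbit is thus closed under rotation and under changing the last letter,
    hence under changing any letter; as replacing one maximal letter by 0 maps
    weak orders to weak orders, the orbit of 0...0 contains every weak order.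
    The universal cycle lists the first letters along this orbit. *)

Set Implicit Arguments.
Unset Strict Implicit.
Unset Printing Implicit Defensive.

(** * Edge permutations of a directed graph and their orbits *)

Lemma porbits_mul_tperm_lt (T : finType) (s : {perm T}) (x y : T) :
  y \notin porbit s x -> #|porbits (s * tperm x y)| < #|porbits s|.
Proof.
(* Passing to inverses, which have the same orbits, moves the transposition from the left factor to
   the right one, so that it acts after [s]. *)
move=> xy; have /= := porbits_mul_tperm s^-1 x y.
rewrite -porbitsV invMg invgK tpermV !porbitsV.
rewrite porbitV porbit_sym xy.
case: eqP xy => [->|_ _] /=; first by rewrite porbit_id.
by rewrite addn1 addn2 => -[<-].
Qed.

(** The orbits of [s] are closed trails that partition the edges; a transposition splices two trails
    at a common source. *)
Lemma eulerian_perm (E : finType) (V : eqType) (src tgt : E -> V)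
    (s0 : {perm E}) :
  (forall e, src (s0 e) = tgt e) ->
  exists2 s : {perm E}, (forall e, src (s e) = tgt e) &
    forall e f, src e = src f -> f \in porbit s e.
Proof.
move=> s0P; pose P (s : {perm E}) := [forall e, src (s e) == tgt e].
have Ps0 : P s0 by apply/forallP => e; rewrite s0P.
case: (arg_minnP (fun s => #|porbits s|) Ps0) => s /forallP sP smin.
exists s => [e|e f eqsrc]; first exact/eqP.
apply: contraT => /porbits_mul_tperm_lt; rewrite ltnNge smin //.
apply/forallP => x; rewrite permM -(eqP (sP x)).
by case: tpermP => [->|->|_ _]; rewrite ?eqsrc.
Qed.

(** Each step of [s] drops the first letter, so the letter at position [j] comes to the front after
    [j] steps. *)
Lemma nth_of_overlaps (E T : Type) (x0 : T) (m : nat) (w : E -> m.-tuple T)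
    (s : E -> E) :
  (forall e, take m.-1 (w (s e)) = behead (w e)) ->
  forall j e, j < m -> nth x0 (w e) j = nth x0 (w (iter j s e)) 0.
Proof.
move=> ws; elim=> [//|j IHj] e jm; rewrite iterSr -IHj ?(ltnW jm) //.
by rewrite -nth_behead -ws nth_take //; lia.
Qed.

(** * From edge permutations to universal cycles *)

Section CyclicOrbit.

Variables (E : finType) (m : nat) (w : E -> m.-tuple nat) (s : {perm E}).
Hypothesis w_inj : injective w.
Hypothesis ws : forall e, take m.-1 (w (s e)) = behead (w e).

Lemma universal_cycle_of_cyclic_perm (e0 : E) :
  (forall e, e \in porbit s e0) ->
  universal_cycle (range w)
    [tuple nth 0 (w (iter k s e0)) 0 | k < #|porbit s e0|].
Proof.
set N := #|porbit s e0| => full.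
have cardE : #|E| = N by rewrite -cardsT; apply: eq_card => e; rewrite inE full.
(* The orbit of [e0] closes up after [N] steps; this absorbs the subscripts modulo [N], even when
   [m] exceeds [N]. *)
have iter_modn k : iter (k %% N) s e0 = iter k s e0.
  rewrite {2}(divn_eq k N) addnC iterD; congr iter.
  by elim: (k %/ N) => // d IHd; rewrite mulSn iterD -IHd iter_porbit.
have N_gt0 : 0 < N by rewrite -cardE; apply/card_gt0P; exists e0.
(* The exponent is [i.+1] because [cyclic_subword] starts at the letter after position [i]. *)
pose f (i : 'I_N) := iter i.+1 s e0.
have f_inj : injective f.
  move=> i j /perm_inj ij; apply/val_inj/eqP; rewrite /=.
  rewrite -(nth_uniq e0 _ _ (uniq_traject_porbit s e0)) ?size_traject //.
  by rewrite !nth_traject //; apply/eqP.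
have f_onto e : exists i, f i = e.
  have [|g fK gK] := inj_card_bij f_inj; first by rewrite cardE card_ord.
  by exists (g e).
have fE (i : 'I_N) : cyclic_subword m
    [tuple nth 0 (w (iter k s e0)) 0 | k < N] i = w (f i).
  apply: eq_from_tnth => j; rewrite tnth_mktuple.
  have lt_mod : (i + j.+1) %% N < N by rewrite ltn_mod.
  rewrite -[(i + j.+1) %% N]/(val (Ordinal lt_mod)) -tnth_nth tnth_mktuple /=.
  rewrite iter_modn (tnth_nth 0) (nth_of_overlaps 0 ws (f i)) // /f -iterD.
  by rewrite addnS -addSn addnC.
split.
  have -> : range w = range (w \o f).
    apply/seteqP; split=> _ [] x _ <-; last by exists (f x).
    by have [i <-] := f_onto x; exists i.
  have wf_card : (range (w \o f) #= [set: 'I_N]%classic)%card.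
    by apply: inj_card_eq => i j _ _ /w_inj/f_inj.
  by rewrite (card_eql wf_card) card_eq_sym card_II.
move=> _ [e _ <-]; have [i fi] := f_onto e; exists i; split=> [|j].
  by rewrite fE fi.
by rewrite fE -fi => /w_inj/f_inj.
Qed.

End CyclicOrbit.

(** The last hypothesis is connectedness of the transition graph, phrased as an induction principle;
    it is used with [A] as membership in the orbit of [c0]. *)
Lemma universal_cycle_of_connected (m : nat) (C : set (m.-tuple nat))
    (c0 : m.-tuple nat) :
  finite_set C ->
  (forall c : m.-tuple nat, C c -> C [tuple of rot 1 c]) ->
  C c0 ->
  (forall A : seq nat -> Prop, A c0 ->
    (forall c : m.-tuple nat, C c -> A c -> A (rot 1 c)) ->
    (forall c d : m.-tuple nat, C c -> C d ->
      take m.-1 c = take m.-1 d -> A c -> A d) ->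
    forall c : m.-tuple nat, C c -> A c) ->
  exists (N : nat) (a : N.-tuple nat), universal_cycle C a.
Proof.
move=> /finite_seqP[l ->] rotC Cc0 conn.
pose w (e : seq_sub l) : m.-tuple nat := val e.
pose rho (e : seq_sub l) : seq_sub l := SeqSub (rotC _ (valP e)).
have rho_inj : injective rho.
  move=> e f [/rot_inj ef].
  exact/val_inj/val_inj.
have take_rot (c : m.-tuple nat) : take m.-1 (rot 1 c) = behead c.
  rewrite /rot drop1 take_size_cat //.
  by rewrite size_behead size_tuple.
have [|s ws sP] := @eulerian_perm _ _ (fun e => take m.-1 (w e))
  (fun e => behead (w e)) (perm rho_inj).
  by move=> e; rewrite permE take_rot.
pose e0 : seq_sub l := SeqSub Cc0.
have full e : e \in porbit s e0.
  pose A (c : seq nat) := exists2 e, e \in porbit s e0 & tval (w e) = c.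
  have Aw f : A (w f) -> f \in porbit s e0.
    by move=> [g gA /val_inj/val_inj <-].
  apply: (Aw); apply: conn; last exact: valP.
  - by exists e0; rewrite ?porbit_id.
  - move=> c Cc; rewrite -[c]/(w (SeqSub Cc)) => /Aw cA.
    exists (rho (SeqSub Cc)) => //.
    (* [s] and [rho] send an edge to edges with the same source, hence in the same orbit. *)
    have /sP : take m.-1 (w (s (SeqSub Cc))) = take m.-1 (w (rho (SeqSub Cc))).
      by rewrite ws take_rot.
    move: cA; rewrite -!eq_porbit_mem -[s (SeqSub Cc)]/(iter 1 s _) -permX.
    by rewrite porbit_perm => /eqP -> /eqP ->.
  - move=> c d Cc Cd cd; rewrite -[c]/(w (SeqSub Cc)) => /Aw cA.
    exists (SeqSub Cd) => //; move: cA.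
    by have /sP := (cd : take m.-1 (w (SeqSub Cc)) = take m.-1 (w (SeqSub Cd)));
      rewrite -!eq_porbit_mem => /eqP -> /eqP ->.
have -> : [set` l]%classic = range w.
  apply/seteqP; split=> [c cl|_ [e _ <-]]; first by exists (SeqSub cl).
  exact: valP.
have w_inj : injective w by exact: val_inj.
exact (ex_intro _ _ (ex_intro _ _
  (universal_cycle_of_cyclic_perm w_inj ws full))).
Qed.

(** * Weak orders as down-closed words, and their connectedness *)

Definition down_closed (s : seq nat) : Prop :=
  forall x k, x \in s -> k <= x -> k \in s.

Lemma down_closed_eq_mem (s t : seq nat) :
  s =i t -> down_closed s -> down_closed t.
Proof. by move=> st ds x k; rewrite -!st; exact: ds. Qed.

(** The [x.+1] numbers up to [x] all occur in [s]. *)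
Lemma down_closed_ltn_size (s : seq nat) (x : nat) :
  down_closed s -> x \in s -> x < size s.
Proof.
move=> ds xs; rewrite -(size_iota 0 x.+1); apply: uniq_leq_size.
  exact: iota_uniq.
by move=> k; rewrite mem_iota => /andP[_ kx]; apply: ds xs _.
Qed.

Lemma mem_bigmax_seq (s : seq nat) : s != [::] -> \max_(x <- s) x \in s.
Proof.
elim: s => // x [|y s] IHs _; first by rewrite big_seq1 mem_seq1.
rewrite big_cons; case: (leqP x (\max_(z <- y :: s) z)) => _.
  by rewrite inE IHs ?orbT.
by rewrite inE eqxx.
Qed.

Lemma weak_ordersP (n : nat) (c : n.-tuple nat) :
  0 < n -> weak_orders n c <-> down_closed c.
Proof.
move=> n_gt0; split=> [[h hn /seteqP[sub1 sub2]] x k /sub1 /= xh kx|dc].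
  by apply: sub2 => /=; apply: leq_trans kx xh.
have maxc : \max_(x <- c) x \in tval c.
  by apply: mem_bigmax_seq; rewrite -size_eq0 size_tuple -lt0n.
(* The height [h] is the largest letter, and counting letters bounds it by [n.-1]. *)
exists (\max_(x <- c) x).
  by have := down_closed_ltn_size dc maxc; rewrite size_tuple; lia.
apply/seteqP; split=> [x /= xc|k /= km]; last exact: dc maxc km.
exact: leq_bigmax_seq.
Qed.

Lemma finite_weak_orders (n : nat) : 0 < n -> finite_set (weak_orders n).
Proof.
move=> n_gt0; pose f (t : n.-tuple 'I_n) : n.-tuple nat := map_tuple val t.
apply: (@sub_finite_set _ _ (range f)); last exact/finite_image/finite_finset.
move=> c /(weak_ordersP _ n_gt0) dc.
have cn i : tnth c i < n.
  by have := down_closed_ltn_size dc (mem_tnth i c); rewrite size_tuple.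
exists [tuple Ordinal (cn i) | i < n] => //.
by apply: eq_from_tnth => i; rewrite tnth_map tnth_mktuple.
Qed.

(** Only the value [x] can disappear, and no letter above it remains to require it. *)
Lemma down_closed_max0 (p q : seq nat) (x : nat) :
  {in p ++ x :: q, forall y, y <= x} ->
  down_closed (p ++ x :: q) -> down_closed (p ++ 0 :: q).
Proof.
move=> xmax ds y k; have := xmax y; have := ds y k.
rewrite !mem_cat !inE.
have [->|k0] := eqVneq k 0; first by rewrite orbT.
have [->|y0] := eqVneq y 0; first by case: k k0.
rewrite !orFb => dsy xy ypq ky.
have /orP[kp|/orP[/eqP kx|kq]] : [|| k \in p, k == x | k \in q].
- by apply: dsy => //; case/orP: ypq => ->; rewrite ?orbT.
- by rewrite kp.
(* Here [x = k <= y <= x], so [y] is another occurrence of [x], in [p] or [q]. *)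
- have -> : k = y by have := xy; rewrite kx in ky *;
    case/orP: ypq => ->; rewrite ?orbT => /(_ isT); lia.
  by [].
- by rewrite kq orbT.
Qed.

(** Induction on the sum of the letters, which drops when a positive maximal letter becomes 0. *)
Lemma down_closed_connected (n : nat) (A : seq nat -> Prop) :
  A (nseq n 0) ->
  (forall s, size s = n -> down_closed s -> A s -> A (rot 1 s)) ->
  (forall s x y, size s = n.-1 -> down_closed (rcons s x) ->
    down_closed (rcons s y) -> A (rcons s x) -> A (rcons s y)) ->
  forall s, size s = n -> down_closed s -> A s.
Proof.
move=> A0 Arot Alast s; have [N] := ubnP (sumn s); elim: N s => // N IHN s.
rewrite ltnS => sN sn ds.
have Arotn k t : size t = n -> down_closed t -> A t -> k <= n -> A (rot k t).
  move=> tn dt At; elim: k => [|k IHk] kn; first by rewrite rot0.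
  rewrite rotS ?tn //; apply: Arot (IHk (ltnW kn)); first by rewrite size_rot.
  by apply: down_closed_eq_mem dt => x; rewrite mem_rot.
have [/all_pred1P s0|s_neq0] := boolP (all (pred1 0) s).
  by rewrite s0 sn.
have s_nil : s != [::] by case: (s) s_neq0.
have xmax : {in s, forall y, y <= \max_(x <- s) x}.
  by move=> y ys; apply: leq_bigmax_seq.
move: (mem_bigmax_seq s_nil) xmax; set x := \max_(_ <- s) _ => xs xmax.
have x_gt0 : 0 < x.
  have /allPn[y ys y0] := s_neq0.
  by apply: leq_trans (xmax y ys); rewrite lt0n.
clearbody x; case/splitPr: xs sN sn ds xmax => p q.
rewrite sumn_cat size_cat /= => sN sn ds xmax.
have d0 := down_closed_max0 xmax ds.
have sn0 : size (p ++ 0 :: q) = n by rewrite size_cat.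
have Ap0 : A (p ++ 0 :: q) by apply: IHN => //; rewrite sumn_cat /=; lia.
have rotE y : rot (size p).+1 (p ++ y :: q) = rcons (q ++ p) y.
  by rewrite -cat_rcons -(size_rcons p y) rot_size_cat rcons_cat.
have rot_mem y : p ++ y :: q =i rcons (q ++ p) y.
  by move=> z; rewrite -rotE mem_rot.
(* The new 0 is rotated to the end and changed back to [x] there; a second rotation then restores
   the original word. *)
have Aqp : A (rcons (q ++ p) x).
  apply: (Alast _ 0).
  - by rewrite size_cat; lia.
  - exact: down_closed_eq_mem (rot_mem 0) d0.
  - exact: down_closed_eq_mem (rot_mem x) ds.
  - rewrite -rotE; apply: Arotn => //.
    by rewrite -sn addnS ltnS leq_addr.
have -> : p ++ x :: q = rot (size q) (rcons (q ++ p) x).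
  by rewrite rcons_cat rot_size_cat cat_rcons.
apply: Arotn Aqp _.
- by rewrite size_rcons size_cat; lia.
- exact: down_closed_eq_mem (rot_mem x) ds.
- by rewrite -sn addnS leqW ?leq_addl.
Qed.

Theorem theorem3p2 (n : nat) (hn : 0 < n) :
  exists (N : nat) (a : N.-tuple nat), universal_cycle (weak_orders n) a.
Proof.
apply: (@universal_cycle_of_connected _ _ [tuple of nseq n 0]) => //.
- exact: finite_weak_orders.
- move=> c /(weak_ordersP _ hn) dc; apply/(weak_ordersP _ hn).
  by apply: down_closed_eq_mem dc => x; rewrite mem_rot.
- apply/(weak_ordersP _ hn) => x k /nseqP[-> _].
  by rewrite leqn0 => /eqP ->; rewrite mem_nseq hn eqxx.
move=> A A0 Arot Alast c /(weak_ordersP _ hn) dc.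
apply: (@down_closed_connected n) dc => //; last exact: size_tuple.
- move=> s /eqP sn ds; apply: (Arot (Tuple sn)).
  exact/(weak_ordersP _ hn).
- move=> s x y sn dx dy.
  have szr z : size (rcons s z) == n by rewrite size_rcons sn prednK.
  apply: (Alast (Tuple (szr x)) (Tuple (szr y))); try exact/(weak_ordersP _ hn).
  by rewrite /= -sn -!cats1 !take_size_cat.
Qed.
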